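(* Let $k$ be a field, let $\sigma,\sigma'$ be index sets, and let $S=k[x_i]_{i\in\sigma}$, $S'=k[x_i]_{i\in\sigma'}$ be equipped with monomial orders $\le_m$ and $\le_{m'}$ respectively, and let $e:\sigma'\to\sigma$ be an embedding of monomial orders; regard $S'$ as a subring of $S$ via $e$. Let $G\subseteq S'$ be a set of polynomials and let $I\subseteq S'$ be an ideal of $S'$. Then $G$ is a Gröbner basis of $I$ over $S'$ if and only if $G$ is a Gröbner basis, over $S$, of the ideal of $S$ generated by $I$.
   Context: For an index set $\sigma$ (possibly infinite), let $\mathcal{M} = (\sigma \to_0 \mathbb{N})$ be the set of finitely supported functions $\sigma\to\mathbb{N}$ (exponent vectors), and similarly $\mathcal{M}'=(\sigma'\to_0\mathbb{N})$. A monomial order is a binary relation $\le$ on $\mathcal{M}$ such that (1) $\le$ is a well-order (a linear order with no infinite strictly descending chain), (2) $a\le b$ implies $a+c\le b+c$ for all $a,b,c$, and (3) $0\le a$ for all $a$. Embedding of monomial orders: given monomial orders $\le_m$ on $\mathcal{M}$ and $\le_{m'}$ on $\mathcal{M}'$, a function $e:\sigma'\to\sigma$ is an embedding if (1) $e$ is injective, and (2) with $e':\mathcal{M}'\to\mathcal{M}$ the map of exponent vectors induced by $e$ (pushforward along $e$, extended by zero outside the image of $e$), $u\le_{m'}v$ implies $e'(u)\le_m e'(v)$ for all $u,v\in\mathcal{M}'$. The ring $S'$ is identified with its image in $S$ under the injective $k$-algebra homomorphism $x_i\mapsto x_{e(i)}$. With respect to a monomial order, for a nonzero polynomial $f=\sum_j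 a_j x^j$, $\deg(f)=\max\{j : a_j\ne 0\}$ and the leading term is $\mathrm{LT}(f)=a_{\deg(f)}x^{\deg(f)}$; $\mathrm{LT}(0)=0$. Gröbner basis: in a polynomial ring $A$ over $k$ with a fixed monomial order, a set $G\subseteq A$ (possibly infinite) is a Gröbner basis of an ideal $J\subseteq A$ (over $A$) if $G\subseteq J$ and $\langle \mathrm{LT}(G)\rangle=\langle \mathrm{LT}(J)\rangle$ as ideals of $A$, where $\mathrm{LT}(G)$, $\mathrm{LT}(J)$ are the sets of leading terms of elements of $G$, $J$. *)

(* Defs.v *)
From HB Require Import structures.
From mathcomp Require Import all_boot all_algebra.
From mathcomp Require Import finmap monalg.
From mathcomp Require Import boolp classical_sets.

Set Implicit Arguments.
Unset Strict Implicit.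
Unset Printing Implicit Defensive.

Import GRing.Theory.
Local Open Scope classical_set_scope.
Local Open Scope ring_scope.

(* Exponent vectors sigma ->_0 nat are [{cmonom sigma}]: finitely supported
   functions, written multiplicatively, so addition of exponents is [mmul] and
   the zero exponent is [mone]. *)
Record monomial_order (I : choiceType) (le : rel {cmonom I}) : Prop := {
  mo_refl : reflexive le;
  mo_anti : antisymmetric le;
  mo_trans : transitive le;
  mo_total : total le;
  mo_wf : ~ exists u : nat -> {cmonom I},
      forall n, le (u n.+1) (u n) /\ u n.+1 <> u n;
  mo_add : forall a b c, le a b -> le (mmul a c) (mmul b c);
  mo_ge0 : forall a, le (mone : {cmonom I}) a }.

Definition push_mono (I J : choiceType) (e : I -> J) (u : {cmonom I}) :
    {cmonom J} :=
  [cmonom (\sum_(i <- finsupp u | e i == j) u i)%N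
     | j in [fset e i | i in finsupp u]%fset]%M.

Lemma push_monoE (I J : choiceType) (e : I -> J) (u : {cmonom I}) j :
  push_mono e u j = (\sum_(i <- finsupp u | e i == j) u i)%N.
Proof.
rewrite /push_mono unlock fsfunE; case: ifP => // /negbT jN.
rewrite big_seq_cond big1// => i /andP[iu /eqP eij].
by case/negP: jN; apply/imfsetP; exists i.
Qed.

Lemma push_mono_image (I J : choiceType) (e : I -> J) (u : {cmonom I}) i :
  injective e -> push_mono e u (e i) = u i.
Proof.
move=> inje; rewrite push_monoE; under eq_bigl do rewrite (inj_eq inje).
case: (boolP (i \in finsupp u)) => iu; last first.
  rewrite (fsfun_dflt iu) big_seq_cond big1// => j /andP[ju /eqP ij].
  by rewrite -ij ju in iu.
rewrite big_mkcond (big_fsetD1 i)//= eqxx big_seq big1 ?addn0// => j.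
by rewrite !inE => /andP[/negbTE->].
Qed.

Lemma push_mono_out (I J : choiceType) (e : I -> J) (u : {cmonom I}) j :
  (forall i, e i <> j) -> push_mono e u j = 0%N.
Proof. by move=> ej; rewrite push_monoE big1// => i /eqP/ej. Qed.

Definition order_embedding (I J : choiceType) (leI : rel {cmonom I})
    (leJ : rel {cmonom J}) (e : I -> J) : Prop :=
  injective e /\
  forall u v, leI u v -> leJ (push_mono e u) (push_mono e v).

(* [{malg k[{cmonom I}]}] is k[x_i]_{i in I}; the variable x_i is
   [<< ucm i >>], and [rename_vars e] is the k-algebra morphism sending x_i to
   x_(e i). *)
Definition rename_vars (k : fieldType) (I J : choiceType) (e : I -> J)
    (f : {malg k[{cmonom I}]}) : {malg k[{cmonom J}]} :=
  mmap (fun c : k => c%:MP)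
    (fun u : {cmonom I} => \prod_(i <- finsupp u) << ucm (e i) >> ^+ u i) f.

Lemma malgUM (K : monomType) (R : nzRingType) (a b : K) :
  << a >> * << b >> = << mmul a b >> :> {malg R[K]}.
Proof. by have := fgmulUU (1 : R) 1 a b; rewrite mulr1. Qed.

Lemma malgUX (K : monomType) (R : nzRingType) (a : K) n :
  << a >> ^+ n = << iter n (mmul a) mone >> :> {malg R[K]}.
Proof. by elim: n => [|n IH]; rewrite ?expr0 ?exprS ?IH ?malgUM. Qed.

Lemma malgU_prod (K : monomType) (R : nzRingType) (I : Type) (s : seq I)
    (g : I -> K) :
  \prod_(i <- s) << g i >> = << \big[mmul/mone]_(i <- s) g i >> :> {malg R[K]}.
Proof.
by elim: s => [|i s IH]; rewrite ?big_nil// !big_cons IH malgUM.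
Qed.

Lemma rename_varsU (k : fieldType) (I J : choiceType) (e : I -> J) (c : k)
    (u : {cmonom I}) :
  rename_vars e << c *g u >> = << c *g push_mono e u >>.
Proof.
have powE (a : {cmonom J}) n j : iter n (mmul a) mone j = (a j * n)%N.
  by elim: n => [|n IH]; [rewrite cm1 muln0 | rewrite iterS cmM IH mulnS].
rewrite /rename_vars mmapU; under eq_bigr do rewrite malgUX.
rewrite malgU_prod mul_malgC.
set b := (X in << X >>); have -> : b = push_mono e u.
  apply/eqP/cmP => j; rewrite push_monoE {}/b.
  elim: (enum_fset (finsupp u)) => [|i s IH]; first by rewrite !big_nil cm1.
  rewrite !big_cons cmM IH powE ucmE.
  by case: eqP => _; rewrite ?mul1n ?mul0n.
by apply/malgP => v; rewrite mcoeffZ [X in _ * X]mcoeffU mcoeffU mulrnAr mulr1.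
Qed.

Section LeadingTerm.
Context (k : fieldType) (I : choiceType) (le : rel {cmonom I}).
Implicit Type f : {malg k[{cmonom I}]}.

(* The fold starts at the zero exponent, which is least for a monomial order;
   hence this is the maximum of the support when f <> 0 ([lead_expP]) and the
   junk value 0 when f = 0. *)
Definition lead_exp f : {cmonom I} :=
  foldr (fun a b => if le a b then b else a) mone (msupp f).

Definition lead_term f : {malg k[{cmonom I}]} :=
  << f@_(lead_exp f) *g lead_exp f >>.

Lemma lead_term0 : lead_term 0 = 0.
Proof. by rewrite /lead_term mcoeff0 monalgU0. Qed.

Lemma lead_expP f : monomial_order le -> f != 0 ->
  lead_exp f \in msupp f /\ {in msupp f, forall u, le u (lead_exp f)}.
Proof.
move=> [lexx lean letr letot _ _ le0] f0; rewrite /lead_exp.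
pose mx := foldr (fun a b => if le a b then b else a) mone.
have mx_ub (s : seq {cmonom I}) u : u \in s -> le u (mx s).
  elim: s => //= a s IH; rewrite inE.
  case: ifP => [leab /predU1P[->//|/IH//]|/negbT nle].
  have {}nle : le (mx s) a by have := letot a (mx s); rewrite (negbTE nle).
  by move=> /predU1P[->//|/IH h]; apply: letr nle.
have mx_in (s : seq {cmonom I}) : s != [::] -> mx s \in s.
  elim: s => //= a [|b s] IH _.
    by rewrite /= inE; case: ifP => // lea1; apply/eqP/lean; rewrite le0.
  by rewrite inE; case: ifP => _; rewrite ?eqxx// IH// orbT.
split; last by move=> u; apply: mx_ub.
apply: mx_in; apply: contra_neq f0 => s0; apply/eqP; rewrite -msupp_eq0.
by apply/eqP/fsetP => u; rewrite in_fset0 -[LHS]/(u \in enum_fset _) s0.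
Qed.

End LeadingTerm.

(* The library's [idealr_closed] only covers proper ideals. *)
Definition is_ideal (R : comNzRingType) (J : set R) : Prop :=
  [/\ J 0, forall x y, J x -> J y -> J (x + y) & forall a x, J x -> J (a * x)].

Definition ideal_gen (R : comNzRingType) (A : set R) : set R :=
  smallest (@is_ideal R) A.

Definition groebner_basis (k : fieldType) (I : choiceType)
    (le : rel {cmonom I}) (G J : set {malg k[{cmonom I}]}) : Prop :=
  G `<=` J /\
  ideal_gen (lead_term le @` G) = ideal_gen (lead_term le @` J).

(* Main.v *)
(** Over [S'], the ring [S] is free on the monomials [x^w] in the variables
    outside the image of [e], and an ideal extended from [J] consists of the
    polynomials all of whose coefficients in this basis lie in [J]; in particular
    it contracts back to [J]. Distinct [w] contribute disjoint supports, so the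
    leading term of [F] is [x^w] times the leading term of its coefficient
    at [w], where [w] is the part of the leading exponent of [F] outside the
    image of [e]. *)
Require Import Defs.
From mathcomp Require Import all_boot all_algebra.
From mathcomp Require Import finmap monalg.
From mathcomp Require Import boolp classical_sets cardinality.

Set Implicit Arguments.
Unset Strict Implicit.
Unset Printing Implicit Defensive.

Import GRing.Theory.
Local Open Scope classical_set_scope.
Local Open Scope ring_scope.

(** * Reduction of additive statements to monomials *)

Lemma malg_ind (K : choiceType) (G : zmodType) (P : {malg G[K]} -> Prop) :
  P 0 -> (forall x y, P x -> P y -> P (x + y)) ->
  (forall c m, P << c *g m >>) -> forall x, P x.
Proof. by move=> P0 PD PU x; rewrite (monalgE x); apply: (big_ind P). Qed.

Lemma malg_additive_ext (K : choiceType) (G V : zmodType)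
    (f g : {malg G[K]} -> V) :
  {morph f : x y / x + y} -> {morph g : x y / x + y} ->
  (forall c m, f << c *g m >> = g << c *g m >>) -> f =1 g.
Proof.
move=> fD gD fgU; have f0 (h : {malg G[K]} -> V) : {morph h : x y / x + y} -> h 0 = 0.
  by move=> hD; apply: (@addrI _ (h 0)); rewrite -hD !addr0.
apply: malg_ind; first by rewrite !f0.
  by move=> x y hx hy; rewrite fD gD hx hy.
exact: fgU.
Qed.

Lemma malgMUU (K : monomType) (R : nzRingType) (c d : R) (m n : K) :
  << c *g m >> * << d *g n >> = << c * d *g mmul m n >> :> {malg R[K]}.
Proof. exact: fgmulUU. Qed.

(** Both sides are additive in [x] and in [y], so only products of two monomials need checking, and
    there [q] does the work. *)
Lemma malg_morphM (K L : monomType) (R : nzRingType)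
    (p : {malg R[K]} -> {malg R[L]}) (q : K -> L) :
  {morph p : x y / x + y} -> (forall c m, p << c *g m >> = << c *g q m >>) ->
  {morph q : m n / mmul m n} -> {morph p : x y / x * y}.
Proof.
move=> pD pU qM x y; apply: (malg_additive_ext (f := fun x => p (x * y))
    (g := fun x => p x * p y)) => [x1 x2|x1 x2|c m] /=.
- by rewrite mulrDl; apply: pD.
- by rewrite pD mulrDl.
apply: (malg_additive_ext (f := fun y => p (<< c *g m >> * y))
    (g := fun y => p << c *g m >> * p y)) => [y1 y2|y1 y2|d n] /=.
- by rewrite mulrDr; apply: pD.
- by rewrite pD mulrDr.
by rewrite malgMUU !pU malgMUU qM.
Qed.

(** * Generated ideals and their images under ring maps *)

Section Ideals.
Context (R : comNzRingType).
Implicit Types A J : set R.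

Lemma is_ideal_gen A : is_ideal (ideal_gen A).
Proof.
split=> [J [[]]//|x y Ax Ay J JA|a x Ax J JA].
  by have [[_ JD _] _] := JA; apply: JD; [apply: Ax | apply: Ay].
by have [[_ _ JM] _] := JA; apply: JM; apply: Ax.
Qed.

Lemma sub_ideal_gen A : A `<=` ideal_gen A.
Proof. by move=> x Ax J [_]; apply. Qed.

Lemma ideal_gen_sub A J : is_ideal J -> A `<=` J -> ideal_gen A `<=` J.
Proof. exact: smallest_sub. Qed.

Lemma ideal_gen_mono A B : A `<=` B -> ideal_gen A `<=` ideal_gen B.
Proof.
move=> AB; apply: ideal_gen_sub; first exact: is_ideal_gen.
exact: subset_trans AB (@sub_ideal_gen B).
Qed.

End Ideals.

(** The preimage under [f] of the ideal generated by the image of [A] is an ideal containing [A]. *)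
Lemma ideal_gen_image (R S : comNzRingType) (f : R -> S) (A : set R) x :
  f 0 = 0 -> {morph f : x y / x + y} -> {morph f : x y / x * y} ->
  ideal_gen A x -> ideal_gen (f @` A) (f x).
Proof.
move=> f0 fD fM; have [I0 ID IM] := is_ideal_gen (f @` A).
apply: (@ideal_gen_sub _ A [set x | ideal_gen (f @` A) (f x)]).
  split=> /= [|y z|a y]; first by rewrite f0.
    by rewrite fD; apply: ID.
  by rewrite fM; apply: IM.
by move=> y Ay; apply: sub_ideal_gen; exists y.
Qed.

Section RenameVars.
Context (k : fieldType) (I J : choiceType) (e : I -> J).
Local Notation phi := (@rename_vars k I J e).

Lemma rename_vars0 : phi 0 = 0.
Proof. exact: mmap0. Qed.

Lemma rename_varsD : {morph phi : x y / x + y}.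
Proof. exact: mmapD. Qed.

End RenameVars.

(** * Splitting exponents along the image of [e] *)

Section Exponents.
Context (I J : choiceType) (e : I -> J).
Hypothesis inje : injective e.
Local Notation push := (push_mono e).
Implicit Types (u v : {cmonom I}) (m n : {cmonom J}).

(** [fset_set] is faithful only on finite sets; injectivity of [e] makes this preimage of the
    support finite. *)
Definition pull_mono m : {cmonom I} :=
  [cmonom m (e i) | i in fset_set (e @^-1` [set` finsupp m])]%M.

Definition off_mono m : {cmonom J} :=
  [cmonom (if `[< exists i, e i = j >] then 0 else m j) | j in finsupp m]%M.

Lemma pull_monoE m i : pull_mono m i = m (e i).
Proof.
rewrite /pull_mono unlock fsfunE in_fset_set; last first.
  by apply: finite_preimage => // x y _ _; apply: inje.
by case: ifP => // /negbT h; rewrite fsfun_dflt//; apply: contra h; rewrite inE.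
Qed.

Lemma off_monoE m j : off_mono m j = if `[< exists i, e i = j >] then 0%N else m j.
Proof.
rewrite /off_mono unlock fsfunE; case: ifP => // /negbT h.
by rewrite fsfun_dflt ?if_same.
Qed.

(** With the next two lemmas, this identifies exponents over [J] with pairs of an exponent over [I]
    and one that vanishes on the image of [e]. *)
Lemma push_pull_off m : mmul (push (pull_mono m)) (off_mono m) = m.
Proof.
apply/eqP/cmP => j; rewrite cmM off_monoE; case: asboolP => [[i <-]|ni].
  by rewrite push_mono_image// pull_monoE addn0.
by rewrite push_mono_out// => i eij; apply: ni; exists i.
Qed.

Lemma pull_push_off u m : pull_mono (mmul (push u) (off_mono m)) = u.
Proof.
apply/eqP/cmP => i; rewrite pull_monoE cmM push_mono_image// off_monoE.
by rewrite asboolT ?addn0//; exists i.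
Qed.

Lemma off_push_off u m : off_mono (mmul (push u) (off_mono m)) = off_mono m.
Proof.
apply/eqP/cmP => j; rewrite off_monoE cmM off_monoE; case: asboolP => // ni.
by rewrite push_mono_out// => i eij; apply: ni; exists i.
Qed.

Lemma pull_monoM m n : pull_mono (mmul m n) = mmul (pull_mono m) (pull_mono n).
Proof. by apply/eqP/cmP => i; rewrite !(cmM, pull_monoE). Qed.

Lemma off_monoM m n : off_mono (mmul m n) = mmul (off_mono m) (off_mono n).
Proof. by apply/eqP/cmP => j; rewrite !(cmM, off_monoE); case: ifP. Qed.

Lemma off_mono1 : off_mono mone = mone.
Proof. by apply/eqP/cmP => j; rewrite off_monoE !cm1 if_same. Qed.

Lemma push_monoM u v : push (mmul u v) = mmul (push u) (push v).
Proof.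
apply/eqP/cmP => j; rewrite cmM.
case: (asboolP (exists i, e i = j)) => [[i <-]|ni].
  by rewrite !push_mono_image// cmM.
by rewrite !push_mono_out// => i eij; apply: ni; exists i.
Qed.

Lemma pull_push u : pull_mono (push u) = u.
Proof. by apply/eqP/cmP => i; rewrite pull_monoE push_mono_image. Qed.

Lemma off_push u : off_mono (push u) = mone.
Proof. by rewrite -[push u]mulm1 -off_mono1 off_push_off. Qed.

Lemma push_inj : injective push.
Proof. exact: can_inj pull_push. Qed.

Lemma mmulIm (K : choiceType) : left_injective (@mmul {cmonom K}).
Proof.
move=> c a b /eqP/cmP ab; apply/eqP/cmP => i.
by have := ab i; rewrite !cmM => /addIn.
Qed.

End Exponents.

(** * Slices of polynomials and of extended ideals *)

Section Slice.
Context (k : fieldType) (I J : choiceType) (e : I -> J).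
Hypothesis inje : injective e.
Local Notation push := (push_mono e).
Local Notation pull := (pull_mono e).
Local Notation off := (off_mono e).
Local Notation phi := (@rename_vars k I J e).
Implicit Types (u v : {cmonom I}) (m n w : {cmonom J}).
Implicit Types (f : {malg k[{cmonom I}]}) (F : {malg k[{cmonom J}]}).

Lemma rename_varsM : {morph phi : x y / x * y}.
Proof.
apply: (malg_morphM (rename_varsD e) (rename_varsU e)) => u v.
exact: push_monoM.
Qed.

Lemma mcoeff_rename_vars f m :
  (phi f)@_m = if off m == mone then f@_(pull m) else 0.
Proof.
apply: (malg_additive_ext (f := fun f => (phi f)@_m)
    (g := fun f => if off m == mone then f@_(pull m) else 0)) => [x y|x y|c u] /=.
- by rewrite rename_varsD; apply: mcoeffD.
- by case: ifP => _; [apply: mcoeffD | rewrite addr0].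
rewrite rename_varsU !mcoeffU; case: (eqVneq (push u) m) => [<-|num].
  by rewrite off_push (pull_push inje) !eqxx.
case: eqP => // om; case: eqP => // upm; case/eqP: num.
by rewrite upm -[RHS](push_pull_off inje) om mulm1.
Qed.

(* The coefficient of [x^w] when [F] is expanded in the basis of monomials
   outside the image of [e]; zero if [w] meets that image. *)
Definition slice w F : {malg k[{cmonom I}]} :=
  mmap (fun c : k => c%:MP)
    (fun m => if off m == w then << pull m >> else 0) F.

Lemma slice0 w : slice w 0 = 0.
Proof. exact: mmap0. Qed.

Lemma sliceD w : {morph slice w : x y / x + y}.
Proof. exact: mmapD. Qed.

Lemma sliceU w c m :
  slice w << c *g m >> = if off m == w then << c *g pull m >> else 0.
Proof.
rewrite /slice mmapU; case: (off m == w); last by rewrite mulr0.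
rewrite mul_malgC; apply/malgP => v.
by rewrite mcoeffZ [X in _ * X]mcoeffU mcoeffU mulrnAr mulr1.
Qed.

(** Writing the slicing exponent as [off m] makes it avoid the image of [e]; at an exponent meeting
    that image the slice is zero and the formula can fail. *)
Lemma mcoeff_slice m F v : (slice (off m) F)@_v = F@_(mmul (push v) (off m)).
Proof.
apply: (malg_additive_ext (f := fun F => (slice (off m) F)@_v)
    (g := fun F => F@_(mmul (push v) (off m)))) => [x y|x y|c n] /=.
- by rewrite sliceD; apply: mcoeffD.
- exact: mcoeffD.
rewrite sliceU mcoeffU; case: eqVneq => [onm|nonm].
  rewrite mcoeffU -onm; congr (_ *+ _); congr nat_of_bool; apply/eqP/eqP => [<-|->].
    by rewrite push_pull_off.
  by rewrite pull_push_off.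
rewrite mcoeff0; case: eqP => // nE; case/eqP: nonm.
by rewrite nE off_push_off.
Qed.

Lemma slice_rename_vars w f : slice w (phi f) = if w == mone then f else 0.
Proof.
apply: (malg_additive_ext (f := fun f => slice w (phi f))
    (g := fun f => if w == mone then f else 0)) => [x y|x y|c u] /=.
- by rewrite rename_varsD; apply: sliceD.
- by case: ifP => // _; rewrite addr0.
by rewrite rename_varsU sliceU off_push (pull_push inje) eq_sym.
Qed.

Lemma slice_monoM w c m F :
  slice w (<< c *g m >> * F) = 0 \/
  exists w', slice w (<< c *g m >> * F) = << c *g pull m >> * slice w' F.
Proof.
(* If [off m] divides [w], the slice at the quotient [w'] is the one that contributes; otherwise no
   term of the product lies over [w]. *)
case: (asboolP (exists w', w = mmul (off m) w')) => [[w' ->]|nw].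
  right; exists w'; apply: (malg_additive_ext
    (f := fun F => slice (mmul (off m) w') (<< c *g m >> * F))
    (g := fun F => << c *g pull m >> * slice w' F)) => [x y|x y|d n] /=.
  - by rewrite mulrDr; apply: sliceD.
  - by rewrite sliceD mulrDr.
  rewrite malgMUU !sliceU off_monoM ![mmul (off m) _]mulmC.
  rewrite (inj_eq (@mmulIm _ (off m))); case: (off n == w'); last by rewrite mulr0.
  by rewrite malgMUU pull_monoM.
left; apply: (malg_additive_ext (f := fun F => slice w (<< c *g m >> * F))
    (g := fun=> 0)) => [x y|x y|d n] /=.
- by rewrite mulrDr; apply: sliceD.
- by rewrite addr0.
rewrite malgMUU sliceU off_monoM; case: eqP => // wE; case: nw.
by exists (off n).
Qed.

Lemma slice_ideal_gen w (A : set {malg k[{cmonom I}]}) F : is_ideal A ->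
  ideal_gen (phi @` A) F -> A (slice w F).
Proof.
(* All [w] are treated at once, since multiplying by a monomial trades the slice at [w] for a slice
   at another exponent. *)
move=> [A0 AD AM] AF; suff: [set F | forall w, A (slice w F)] F by apply.
apply: ideal_gen_sub AF => [|_ [f Af <-] v] /=; last first.
  by rewrite slice_rename_vars; case: ifP.
split=> /= [v|x y Ax Ay v|a x Ax v]; first by rewrite slice0.
  by rewrite sliceD; apply: AD.
elim/malg_ind: a v => [|a b ha hb|c m] v.
- by rewrite mul0r slice0.
- by rewrite mulrDl sliceD; apply: AD; [apply: ha | apply: hb].
by have [->//|[w' ->]] := slice_monoM v c m x; apply: AM.
Qed.

Lemma rename_vars_ideal_gen A f :
  ideal_gen A f -> ideal_gen (phi @` A) (phi f).
Proof.
exact: ideal_gen_image (rename_vars0 _ _) (rename_varsD _) rename_varsM.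
Qed.

(** Contraction of an extended ideal: the slice at [mone] is a left inverse of [phi] and maps the
    extension back into the ideal. *)
Lemma rename_vars_ideal_genI A f :
  ideal_gen (phi @` A) (phi f) -> ideal_gen A f.
Proof.
move=> Af; rewrite -[f](_ : slice mone (phi f) = f); last first.
  by rewrite slice_rename_vars eqxx.
apply: slice_ideal_gen; first exact: is_ideal_gen.
by apply: ideal_gen_mono Af; apply: image_subset; apply: sub_ideal_gen.
Qed.

End Slice.

(** * Leading terms under the embedding and under slicing *)

Lemma lead_exp_eq (k : fieldType) (I : choiceType) (le : rel {cmonom I})
    (f : {malg k[{cmonom I}]}) m :
  monomial_order le -> m \in msupp f -> {in msupp f, forall u, le u m} ->
  lead_exp le f = m.
Proof.
move=> ord mf mub; have f0 : f != 0 by apply: contraTneq mf => ->; rewrite msupp0.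
have [lf lub] := lead_expP ord f0.
by apply: (mo_anti ord); rewrite lub// mub.
Qed.

Section Embedding.
Context (k : fieldType) (I J : choiceType).
Context (leI : rel {cmonom I}) (leJ : rel {cmonom J}) (e : I -> J).
Hypotheses (ordI : monomial_order leI) (ordJ : monomial_order leJ).
Hypothesis emb : order_embedding leI leJ e.
Local Notation push := (push_mono e).
Local Notation pull := (pull_mono e).
Local Notation off := (off_mono e).
Local Notation phi := (@rename_vars k I J e).
Let inje : injective e := emb.1.

(** The support of [phi f] is the [push] of that of [f], and [push] is monotone, so it carries
    maximum to maximum. *)
Lemma lead_term_rename_vars f : lead_term leJ (phi f) = phi (lead_term leI f).
Proof.
have [->|f0] := eqVneq f 0; first by rewrite !(rename_vars0, lead_term0).
have [lf lub] := lead_expP ordI f0.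
have coefE u : (phi f)@_(push u) = f@_u.
  by rewrite (mcoeff_rename_vars inje) off_push (pull_push inje) eqxx.
rewrite /lead_term rename_varsU.
suff -> : lead_exp leJ (phi f) = push (lead_exp leI f) by rewrite coefE.
apply: lead_exp_eq => //; first by rewrite -mcoeff_neq0 coefE mcoeff_neq0.
move=> m; rewrite -mcoeff_neq0 (mcoeff_rename_vars inje).
case: (off m =P mone) => [om|_]; last by rewrite eqxx.
rewrite mcoeff_neq0 => /lub/(emb.2).
by rewrite -[m in X in _ -> X](push_pull_off inje) om mulm1.
Qed.

(** The embedding preserves order by definition; it also reflects it because [leI] is total: in the
    opposite case antisymmetry and cancellation of [w] force [u = v]. *)
Lemma push_mono_leM u v w :
  leJ (mmul (push u) w) (mmul (push v) w) -> leI u v.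
Proof.
move=> uvw; have /orP[//|vu] := mo_total ordI u v.
have /(_ w) vuw := mo_add ordJ _ (emb.2 _ _ vu).
have /mmulIm/(push_inj inje)-> := mo_anti ordJ (introT andP (conj uvw (vuw))).
exact: mo_refl ordI v.
Qed.

Lemma lead_term_slice F : let w := off (lead_exp leJ F) in
  lead_term leJ F = << w >> * phi (lead_term leI (slice e w F)).
Proof.
(* For [F = 0] the exponent [w] is a junk value, but both sides vanish. *)
have [->|F0] /= := eqVneq F 0.
  by rewrite slice0 !lead_term0 rename_vars0 mulr0.
have [lF lub] := lead_expP ordJ F0.
set m := lead_exp leJ F in lF lub *; set f := slice e _ F.
have coefE v : f@_v = F@_(mmul (push v) (off m)) by apply: mcoeff_slice.
have fE : lead_exp leI f = pull m.
  apply: lead_exp_eq => //.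
    by rewrite -mcoeff_neq0 coefE (push_pull_off inje) mcoeff_neq0.
  move=> u; rewrite -mcoeff_neq0 coefE mcoeff_neq0 => /lub um.
  (* All terms of [F] seen by this slice share the factor [off m], which can be stripped from the
     comparison with [m]. *)
  by apply: (@push_mono_leM _ _ (off m)); rewrite push_pull_off.
rewrite /lead_term fE rename_varsU malgMUU coefE (push_pull_off inje).
by rewrite mul1r mulmC push_pull_off.
Qed.

End Embedding.

(** * Transfer of Gröbner bases between the two rings *)

Theorem lemma3 (k : fieldType) (sigma sigma' : choiceType)
    (le_m : rel {cmonom sigma}) (le_m' : rel {cmonom sigma'})
    (hm : monomial_order le_m) (hm' : monomial_order le_m')
    (e : sigma' -> sigma) (he : order_embedding le_m' le_m e)
    (G I : set {malg k[{cmonom sigma'}]}) (hI : is_ideal I) :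
  groebner_basis le_m' G I <->
  groebner_basis le_m (rename_vars e @` G) (ideal_gen (rename_vars e @` I)).
Proof.
have inje := he.1.
have ltGE (A : set {malg k[{cmonom sigma'}]}) :
    lead_term le_m @` (rename_vars e @` A) = rename_vars e @` (lead_term le_m' @` A).
  apply/seteqP; split=> _ [_ [f Af <-] <-].
    exists (lead_term le_m' f); first by exists f.
    exact/esym/(lead_term_rename_vars hm' hm he).
  exists (rename_vars e f); first by exists f.
  exact: (lead_term_rename_vars hm' hm he).
split=> -[GI ltE].
  have subI : rename_vars e @` G `<=` ideal_gen (rename_vars e @` I).
    move=> _ [g Gg <-]; apply: sub_ideal_gen; exists g => //; exact: GI.
  split=> //; apply/seteqP; split.
    by apply: ideal_gen_mono; apply: image_subset.
  apply: ideal_gen_sub; first exact: is_ideal_gen.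
  (* The leading term of [F] is a multiple of the image of the leading term of one slice; that slice
     lies in [I], so the hypothesis over the smaller ring applies to it. *)
  move=> _ [F IF <-]; rewrite (lead_term_slice hm' hm he) ltGE.
  have [_ _ idM] := is_ideal_gen (rename_vars e @` (lead_term le_m' @` G)).
  apply: idM; apply: (rename_vars_ideal_gen inje); rewrite ltE.
  apply: sub_ideal_gen; exists (slice e (off_mono e (lead_exp le_m F)) F) => //.
  exact: slice_ideal_gen IF.
have GI' : G `<=` I.
  (* Slicing at [mone] recovers [g] from its image and lands in [I]. *)
  move=> g Gg; have /(slice_ideal_gen inje mone hI) := GI _ (imageP _ Gg).
  by rewrite (slice_rename_vars inje) eqxx.
split=> //; apply/seteqP; split.
  by apply: ideal_gen_mono; apply: image_subset.
apply: ideal_gen_sub; first exact: is_ideal_gen.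
(* By contraction, membership of the leading term of [f] may be tested in the larger ring, where the
   hypothesis applies to the image of [f]. *)
move=> _ [f If <-]; apply: (rename_vars_ideal_genI inje).
rewrite -ltGE ltE -(lead_term_rename_vars hm' hm he).
apply: sub_ideal_gen; exists (rename_vars e f) => //.
by apply: sub_ideal_gen; exists f.
Qed.
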